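(* Let $(M,\boldsymbol{g})$ be an $n$-dimensional manifold with metric of arbitrary signature, let $2\le p<n$, and let $\boldsymbol{H}$ be a closed conformal Killing-Yano tensor of order $p$ on $M$, so that $\nabla_aH_{b_1b_2\cdots b_p}=2g_{a[b_1}h_{b_2\cdots b_p]}$ with $\boldsymbol h$ skew-symmetric of rank $p-1$. Write $E=e_3\cdots e_p$ and $h'_{bdE}=\nabla_b h_{dE}$. Then $$h'_{bdE}=\frac{p}{4(n-p)}\left(2R_b{}^{f}H_{dfE}+R^{af}{}_{bd}H_{afE}+R^{a\hat f}{}_{b\hat e}H_{ad\hat F}\right)$$ and $$R_{abc}{}^{f}H_{fdE}+R_{abd}{}^{f}H_{cfE}+R_{ab\hat e}{}^{\hat f}H_{cd\hat F}-2h'_{a[dE}\,g_{c]b}+2h'_{b[dE}\,g_{c]a}=0 .$$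
   Context: $\nabla$ is the Levi-Civita connection of $\boldsymbol g$. Square brackets denote normalized (weight one) antisymmetrization over the enclosed indices; in $h'_{a[dE}\,g_{c]b}$ it is over the $p$ indices $d,e_3,\dots,e_p,c$, in this order. A closed conformal Killing-Yano tensor of order $p$ is a totally skew-symmetric tensor $\boldsymbol H$ of rank $p$ for which there is a skew-symmetric tensor $\boldsymbol h$ of rank $p-1$ with $\nabla_aH_{b_1b_2\cdots b_p}=2g_{a[b_1}h_{b_2\cdots b_p]}$. The Riemann tensor is fixed by $(\nabla_a\nabla_b-\nabla_b\nabla_a)V_c=R_{abc}{}^{f}V_f$; the Ricci tensor is $R^a{}_b=R^{ca}{}_{cb}$. Collective indices: $E=e_3e_4\cdots e_p$ is a block of $p-2$ indices. When $\hat e$, $\hat f$, $\hat F$ occur, a sum over the position in the block is understood, with the index $e_i$ of $H$ replaced by the contracted index $f$; e.g. $$R_{ab\hat e}{}^{\hat f}H_{cd\hat F}=\sum_{i=3}^{p}R_{abe_i}{}^{f}H_{cde_3\cdots e_{i-1}fe_{i+1}\cdots e_p},$$ $$R^{a\hat f}{}_{b\hat e}H_{ad\hat F}=\sum_{i=3}^{p}R^{af}{}_{be_i}H_{ade_3\cdots e_{i-1}fe_{i+1}\cdots e_p}.$$ For $p=2$ the block $E$ is empty and these terms are absent. *)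

(* Defs.v *)
(* Tensor calculus on a smooth manifold over R^n, R : realType.  Tensor fields
   are given classically, by their components in every chart of an atlas,
   subject to the transformation law.  Points of R^n are row vectors, and a
   string of k indices is a k.-tuple 'I_n. *)
From HB Require Import structures.
From mathcomp Require Import all_boot all_order all_algebra all_fingroup.
From mathcomp Require Import all_classical all_reals all_analysis.
Set Implicit Arguments.
Unset Strict Implicit.
Unset Printing Implicit Defensive.
Import Order.TTheory GRing.Theory Num.Theory.
Import numFieldNormedType.Exports.
Local Open Scope classical_set_scope.
Local Open Scope ring_scope.

(** * Smooth functions on open subsets of R^n *)

Section Smooth.
Variables (R : realType) (n : nat).
Implicit Types (U : set 'rV[R]_n) (f : 'rV[R]_n -> R).

Definition partial (i : 'I_n) f : 'rV[R]_n -> R :=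
  fun x => 'D_(delta_mx 0 i) f x.

(* All partial derivatives up to order k exist and are continuous at every
   point of U; meant for open U. *)
Fixpoint Ck_on (k : nat) U f : Prop :=
  (forall x, U x -> {for x, continuous f}) /\
  (if k is k'.+1 then
     forall i : 'I_n, (forall x, U x -> derivable f x (delta_mx 0 i)) /\
                      Ck_on k' U (partial i f)
   else True).

Definition smooth_on U f : Prop := forall k, Ck_on k U f.

End Smooth.

(** * Manifolds *)

Record chart (R : realType) (n : nat) (M : topologicalType) := Chart {
  chart_dom : set M ;
  chart_map : M -> 'rV[R]_n ;
  chart_inv : 'rV[R]_n -> M ;
  chart_dom_open : open chart_dom ;
  chart_img_open : open (chart_map @` chart_dom) ;
  chart_mapK : {in chart_dom, cancel chart_map chart_inv} ;
  chart_map_cont : {within chart_dom, continuous chart_map} ;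
  chart_inv_cont : {within chart_map @` chart_dom, continuous chart_inv} }.

Definition chart_img R n M (c : chart R n M) : set 'rV[R]_n :=
  chart_map c @` chart_dom c.

Definition overlap R n M (c d : chart R n M) : set 'rV[R]_n :=
  chart_map c @` (chart_dom c `&` chart_dom d).

(* The i-th coordinate of chart d as a function of the coordinates of
   chart c. *)
Definition transition R n M (c d : chart R n M) (i : 'I_n) : 'rV[R]_n -> R :=
  fun x => chart_map d (chart_inv c x) 0 i.

Record manifold (R : realType) (n : nat) := Manifold {
  manifold_space :> topologicalType ;
  manifold_hausdorff : hausdorff_space manifold_space ;
  manifold_second_countable : @second_countable manifold_space ;
  chart_index : Type ;
  charts : chart_index -> chart R n manifold_space ;
  charts_cover : forall m, exists c, chart_dom (charts c) m ;
  charts_compat : forall c d i,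
    smooth_on (overlap (charts c) (charts d))
              (transition (charts c) (charts d) i) }.

Arguments charts {R n} _ _.

Definition coord_dom R n (M : manifold R n) (c : chart_index M) :
    set 'rV[R]_n :=
  chart_img (charts M c).

(** * Covariant tensor fields *)

(* Component functions, in one coordinate system, of a covariant tensor
   field of rank k. *)
Definition components (R : realType) (n k : nat) :=
  'rV[R]_n -> k.-tuple 'I_n -> R.

(* The law is T_{i_1 ... i_k} = (dy^{j_1}/dx^{i_1}) ... (dy^{j_k}/dx^{i_k})
   T'_{j_1 ... j_k}, with x the coordinates of chart c and y those of d. *)
Record tensorField R n (M : manifold R n) (k : nat) := TensorField {
  tcomp :> chart_index M -> components R n k ;
  tcomp_smooth : forall c I, smooth_on (coord_dom c) (fun x => tcomp c x I) ;
  tcomp_law : forall c d m,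
    chart_dom (charts M c) m -> chart_dom (charts M d) m ->
    forall I : k.-tuple 'I_n,
      tcomp c (chart_map (charts M c) m) I =
      \sum_(J : k.-tuple 'I_n)
        (\prod_(s < k) partial (tnth I s)
                         (transition (charts M c) (charts M d) (tnth J s))
                         (chart_map (charts M c) m)) *
        tcomp d (chart_map (charts M d) m) J }.

Section Indices.
Variables (R : realType) (n : nat).

Definition permute k (I : k.-tuple 'I_n) (s : 'S_k) : k.-tuple 'I_n :=
  [tuple tnth I (s j) | j < k].

(* The string I with its entry at position i replaced by f. *)
Definition replace k (I : k.-tuple 'I_n) (i : 'I_k) (f : 'I_n) :
    k.-tuple 'I_n :=
  [tuple (if j == i then f else tnth I j) | j < k].

(* T_{[I]}, of weight one. *)
Definition antisym k (T : k.-tuple 'I_n -> R) (I : k.-tuple 'I_n) : R :=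
  (k`!%:R)^-1 * \sum_(s : 'S_k) (-1) ^+ s * T (permute I s).

Definition last_index k (I : k.+1.-tuple 'I_n) : 'I_n := tnth I ord_max.

Definition init_indices k (I : k.+1.-tuple 'I_n) : k.-tuple 'I_n :=
  [tuple tnth I (widen_ord (leqnSn k) j) | j < k].

End Indices.

Definition skew R n (M : manifold R n) k (T : tensorField M k) : Prop :=
  forall c x, coord_dom c x ->
  forall I (s : 'S_k), T c x (permute I s) = (-1) ^+ s * T c x I.

(** * Metrics, Levi-Civita connection, curvature *)

(* No condition on the signature. *)
Record metric R n (M : manifold R n) := Metric {
  metric_tensor :> tensorField M 2 ;
  metric_sym : forall c x, coord_dom c x -> forall a b,
    metric_tensor c x [tuple a; b] = metric_tensor c x [tuple b; a] ;
  metric_nondeg : forall c x, coord_dom c x ->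
    \matrix_(a, b) metric_tensor c x [tuple a; b] \in unitmx }.

Section LeviCivita.
Variables (R : realType) (n : nat) (g : components R n 2).

Definition metric_inv (x : 'rV[R]_n) (a b : 'I_n) : R :=
  invmx (\matrix_(i, j) g x [tuple i; j]) a b.

(* christoffel x c a b is Gamma^c_{ab}. *)
Definition christoffel (x : 'rV[R]_n) (c a b : 'I_n) : R :=
  2^-1 * \sum_(d < n) metric_inv x c d *
    (partial a (fun y => g y [tuple b; d]) x
     + partial b (fun y => g y [tuple a; d]) x
     - partial d (fun y => g y [tuple a; b]) x).

(* The derivative index comes first: covd T x [tuple a, b_1, ..., b_k] is
   nabla_a T_{b_1 ... b_k}, and covd (covd T) starts with nabla_a nabla_b. *)
Definition covd k (T : components R n k) : components R n k.+1 :=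
  fun x I =>
    let a := thead I in let B := [tuple of behead I] in
    partial a (fun y => T y B) x
    - \sum_(i < k) \sum_(f < n)
        christoffel x f a (tnth B i) * T x (replace B i f).

End LeviCivita.

Section Curvature.
Variables (R : realType) (n : nat) (M : manifold R n) (g : metric M).

(* Rm c x a b d f is R_{abd}^f in chart c, with f the only upper index. *)
Definition curvature_components :=
  chart_index M -> 'rV[R]_n -> 'I_n -> 'I_n -> 'I_n -> 'I_n -> R.

(* (nabla_a nabla_b - nabla_b nabla_a) V_d = R_{abd}^f V_f for every smooth
   covector field V defined on the domain of a chart. *)
Definition is_riemann (Rm : curvature_components) : Prop :=
  forall (c : chart_index M) (V : components R n 1),
  (forall I, smooth_on (coord_dom c) (fun x => V x I)) ->
  forall x, coord_dom c x -> forall a b d : 'I_n,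
    covd (g c) (covd (g c) V) x [tuple a; b; d]
    - covd (g c) (covd (g c) V) x [tuple b; a; d]
    = \sum_(f < n) Rm c x a b d f * V x [tuple f].

Variables (Rm : curvature_components) (c : chart_index M) (x : 'rV[R]_n).

(* R_{abdf} *)
Definition riem_down (a b d f : 'I_n) : R :=
  \sum_(e < n) Rm c x a b d e * g c x [tuple e; f].

(* R^{ab}_{df} *)
Definition riem_up12 (a b d f : 'I_n) : R :=
  \sum_(i < n) \sum_(j < n)
    metric_inv (g c) x a i * metric_inv (g c) x b j * riem_down i j d f.

(* R^a_b = R^{ca}_{cb} *)
Definition ricci (a b : 'I_n) : R := \sum_(e < n) riem_up12 e a e b.

(* R_b^f = g_{bi} g^{fj} R^i_j *)
Definition ricci_down_up (b f : 'I_n) : R :=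
  \sum_(i < n) \sum_(j < n)
    g c x [tuple b; i] * metric_inv (g c) x f j * ricci i j.

End Curvature.

(** * Closed conformal Killing-Yano tensors *)

(* H, of order p = k.+1, is a closed conformal Killing-Yano tensor and h is
   the tensor of rank p - 1 with nabla_a H_B = 2 g_{a[b_1} h_{b_2 ... b_p]}. *)
Definition closed_CKY_with R n (M : manifold R n) (g : metric M) k
    (H : tensorField M k.+1) (h : tensorField M k) : Prop :=
  [/\ skew H, skew h &
   forall c x, coord_dom c x -> forall (a : 'I_n) (B : k.+1.-tuple 'I_n),
     covd (g c) (H c) x [tuple of a :: B] =
     2 * antisym (fun I => g c x [tuple a; thead I] *
                           h c x [tuple of behead I]) B].

(* h'_{a[dE} g_{e]b}, antisymmetrized over the string d, E, e; hp stands for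
   h' = nabla h at a point and gx for g. *)
Definition hp_g_antisym (R : realType) n m (hp : m.+2.-tuple 'I_n -> R)
    (gx : 2.-tuple 'I_n -> R) (a b d : 'I_n) (E : m.-tuple 'I_n) (e : 'I_n) :
    R :=
  antisym (fun I : m.+2.-tuple 'I_n =>
             hp [tuple of a :: init_indices I] * gx [tuple last_index I; b])
          [tuple of rcons [tuple of d :: E] e].

(* Main.v *)
Require Import Defs.
From HB Require Import structures.
From mathcomp Require Import all_boot all_order all_algebra all_fingroup.
From mathcomp Require Import all_classical all_reals all_analysis.
From mathcomp Require Import ring lra.
Set Implicit Arguments.
Unset Strict Implicit.
Unset Printing Implicit Defensive.
Import Order.TTheory GRing.Theory Num.Theory.
Import numFieldNormedType.Exports.
Local Open Scope classical_set_scope.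
Local Open Scope ring_scope.

(* By the Ricci identity, commuting covariant derivatives in the closed
   conformal Killing-Yano equation gives the second formula, since nabla g = 0 moves both
   derivatives onto h.  Contracting that formula once with the inverse metric
   expresses h' through R * H and the trace of h'.  A second contraction kills
   the curvature terms (symmetry of the Ricci tensor, antisymmetry and the first
   Bianchi identity against the skew H) and leaves 2 (n - p + 1) times the trace,
   which therefore vanishes; the Bianchi identity puts the remaining curvature
   terms in the stated form. *)

(** * Partial derivatives *)

(** Both formulas are pointwise identities in one chart. Calculus is needed only to reach the
    commutator formula at [x]; afterwards [g], its inverse, the lowered curvature [Q], [H] and [h']
    are arrays of numbers, and the contractions are pure linear algebra. [Rm] is given only through
    its action on covector fields, so it is first identified with the coordinate expression [curv];
    only then does the commutator act on [H]. The constants arise as follows. Since [h'] is skew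
    after its derivative index, antisymmetrizing [g h'] over [p] slots leaves [p] terms of weight
    [1/p]; with the 2 of the defining equation the metric side carries [kappa = 2/p]. The first
    contraction turns it into [kappa (n - p) h'] plus traces of [h'] over the derivative index. No
    hypothesis gives these traces directly, which is why a second contraction is made. On the
    curvature side a block [Q_{abel}] meets the skew [H] in [b] and [l], and the Bianchi identity
    turns it into one half of [Q_{blae}]; pulling out this half gives the 4 in the denominator and
    the 2 before the Ricci term. *)

Section PartialDerivatives.
Variables (R : realType) (n : nat).
Implicit Types (f g : 'rV[R]_n -> R) (x v : 'rV[R]_n).

Lemma near_along_line x v (P : set 'rV[R]_n) :
  (\forall y \near x, P y) -> \forall h \near 0^', P (h *: v + x).
Proof.
move=> Px; apply: cvg_within.
have : (fun h : R => h *: v + x) @ (0 : R) --> x.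
  suff : (fun h : R => h *: v + x) @ (0 : R) --> 0 *: v + x.
    by rewrite scale0r add0r.
  by apply: cvgD; [exact: scalel_continuous|exact: cvg_cst].
by apply.
Qed.

Lemma near_derivative f g x v : (\forall y \near x, f y = g y) ->
  (derivable f x v -> derivable g x v) /\ 'D_v f x = 'D_v g x.
Proof.
move=> fg; have fgx : f x = g x by exact: (nbhs_singleton fg).
have E : {near 0^', (fun h : R => h^-1 *: ((f \o shift x) (h *: v) - f x)) =1
    (fun h : R => h^-1 *: ((g \o shift x) (h *: v) - g x))}.
  by have := near_along_line v fg; apply: filterS => h /= ->; rewrite fgx.
have E' : {near 0^', (fun h : R => h^-1 *: ((g \o shift x) (h *: v) - g x)) =1
    (fun h : R => h^-1 *: ((f \o shift x) (h *: v) - f x))}.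
  by move: E; apply: filterS => h ->.
split.
  move=> /cvg_ex[l fl]; apply/cvg_ex; exists l.
  by apply: cvg_trans fl; exact: near_eq_cvg.
(* [lim] depends only on the image filter, so the derivatives agree without any convergence: the two
   filters are equal as sets. *)
rewrite /derive; congr (lim _); apply/seteqP; split; last first.
  exact: (near_eq_cvg E').
exact: (near_eq_cvg E).
Qed.

(** Derivability along the axes only: [smooth_on] provides exactly this, and the rules of calculus
    hold direction by direction. *)
Definition pderivable f x := forall i : 'I_n, derivable f x (delta_mx 0 i).

Lemma pderivable_near f g x : (\forall y \near x, f y = g y) ->
  pderivable f x -> pderivable g x.
Proof. by move=> fg df i; apply: (near_derivative _ fg).1. Qed.

Lemma partial_near i f g x : (\forall y \near x, f y = g y) ->
  partial i f x = partial i g x.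
Proof. by move=> fg; exact: (near_derivative _ fg).2. Qed.

Lemma pderivable_cst (a : R) x : pderivable (fun=> a) x.
Proof. by move=> i; exact: derivable_cst. Qed.

Lemma pderivableD f g x : pderivable f x -> pderivable g x ->
  pderivable (fun y => f y + g y) x.
Proof. by move=> df dg i; exact: derivableD. Qed.

Lemma pderivableB f g x : pderivable f x -> pderivable g x ->
  pderivable (fun y => f y - g y) x.
Proof. by move=> df dg i; exact: derivableB. Qed.

Lemma pderivableM f g x : pderivable f x -> pderivable g x ->
  pderivable (fun y => f y * g y) x.
Proof. by move=> df dg i; exact: derivableM. Qed.

Lemma pderivableV f x : f x != 0 -> pderivable f x ->
  pderivable (fun y => (f y)^-1) x.
Proof. by move=> f0 df i; exact: derivableV. Qed.

Lemma pderivable_sum (I : Type) (r : seq I) (P : pred I)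
    (F : I -> 'rV[R]_n -> R) x :
  (forall i, pderivable (F i) x) ->
  pderivable (fun y => \sum_(i <- r | P i) F i y) x.
Proof.
move=> dF; elim: r => [|i r IHr].
  by rewrite (_ : (fun _ => _) = fun=> 0);
    [exact: pderivable_cst|apply/funext => y; rewrite big_nil].
under eq_fun do rewrite big_cons.
by case: (P i); [exact: (pderivableD (dF i) IHr)|exact: IHr].
Qed.

Lemma pderivable_prod (I : Type) (r : seq I) (P : pred I)
    (F : I -> 'rV[R]_n -> R) x :
  (forall i, pderivable (F i) x) ->
  pderivable (fun y => \prod_(i <- r | P i) F i y) x.
Proof.
move=> dF; elim: r => [|i r IHr].
  by rewrite (_ : (fun _ => _) = fun=> 1);
    [exact: pderivable_cst|apply/funext => y; rewrite big_nil].
under eq_fun do rewrite big_cons.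
by case: (P i); [exact: (pderivableM (dF i) IHr)|exact: IHr].
Qed.

Lemma partial_cst i (a : R) x : partial i (fun=> a) x = 0.
Proof. exact: derive_cst. Qed.

Lemma partialD i f g x : pderivable f x -> pderivable g x ->
  partial i (fun y => f y + g y) x = partial i f x + partial i g x.
Proof. by move=> df dg; exact: deriveD. Qed.

Lemma partialB i f g x : pderivable f x -> pderivable g x ->
  partial i (fun y => f y - g y) x = partial i f x - partial i g x.
Proof. by move=> df dg; exact: deriveB. Qed.

Lemma partialM i f g x : pderivable f x -> pderivable g x ->
  partial i (fun y => f y * g y) x
  = f x * partial i g x + partial i f x * g x.
Proof. by move=> df dg; rewrite [X in _ + X]mulrC; exact: deriveM. Qed.

Lemma partial_sum i (I : Type) (r : seq I) (P : pred I)
    (F : I -> 'rV[R]_n -> R) x :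
  (forall i, pderivable (F i) x) ->
  partial i (fun y => \sum_(i <- r | P i) F i y) x
  = \sum_(j <- r | P j) partial i (F j) x.
Proof.
move=> dF; elim: r => [|j r IHr].
  rewrite (_ : (fun _ => _) = fun=> 0) ?partial_cst ?big_nil//.
  by apply/funext => y; rewrite big_nil.
under eq_fun do rewrite big_cons.
rewrite big_cons; case: (P j) => //.
by rewrite partialD ?IHr//; exact: pderivable_sum.
Qed.

Lemma smooth_pderivable (U : set 'rV[R]_n) f x :
  smooth_on U f -> U x -> pderivable f x.
Proof. by move=> sf Ux i; have [_ /(_ i)[+ _]] := sf 1; exact. Qed.

Lemma smooth_partial (U : set 'rV[R]_n) f i :
  smooth_on U f -> smooth_on U (partial i f).
Proof. by move=> sf k; have [_ /(_ i)[]] := sf k.+1. Qed.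

Lemma smooth_cst (U : set 'rV[R]_n) (a : R) : smooth_on U (fun=> a).
Proof.
move=> k; elim: k a => [|k IHk] a;
  (split; first by move=> x _; exact: cst_continuous).
  by [].
move=> i; split=> [x _|]; first exact: pderivable_cst.
rewrite (_ : partial i _ = fun=> 0)//.
by apply/funext => y; rewrite partial_cst.
Qed.

Lemma pderivable_det m (A : 'rV[R]_n -> 'M[R]_m) x :
  (forall i j, pderivable (fun y => A y i j) x) ->
  pderivable (fun y => \det (A y)) x.
Proof.
move=> dA; apply: pderivable_sum => s; apply: pderivableM.
  exact: pderivable_cst.
exact: pderivable_prod.
Qed.

(** By Cramer's rule the entries are, near [x], cofactors divided by a nonzero determinant. *)
Lemma pderivable_invmx m (A : 'rV[R]_n -> 'M[R]_m) x :
  (\forall y \near x, A y \in unitmx) ->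
  (forall i j, pderivable (fun y => A y i j) x) ->
  forall i j, pderivable (fun y => invmx (A y) i j) x.
Proof.
move=> Au dA i j.
apply: (@pderivable_near
  (fun y => (\det (A y))^-1 * cofactor (A y) j i)).
  by apply: filterS Au => y Ay; rewrite /invmx Ay !mxE.
apply: pderivableM.
  apply: pderivableV; last exact: pderivable_det.
  by have := nbhs_singleton Au; rewrite /= unitmxE unitfE.
apply: pderivableM; first exact: pderivable_cst.
apply: pderivable_det => k l.
rewrite (_ : (fun _ => _) = fun y => A y (lift j k) (lift i l))//.
by apply/funext => y; rewrite !mxE.
Qed.

End PartialDerivatives.

(** * Covariant derivatives and their commutator *)

Notation "a ::: B" := (cons_tuple a B) (at level 60, right associativity).

(** * Strings of indices: replacing and permuting entries *)

Section IndexStrings.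
Variable n : nat.
Implicit Types a b f : 'I_n.

Lemma tnth_cons0 k a (B : k.-tuple 'I_n) : tnth (a ::: B) ord0 = a.
Proof. exact: tnth0. Qed.

Lemma tnth_consS k a (B : k.-tuple 'I_n) i :
  tnth (a ::: B) (lift ord0 i) = tnth B i.
Proof. exact: tnthS. Qed.

Lemma behead_cons k a (B : k.-tuple 'I_n) : behead_tuple (a ::: B) = B.
Proof. exact: val_inj. Qed.

Lemma tnth_replace k (B : k.-tuple 'I_n) i f j :
  tnth (replace B i f) j = if j == i then f else tnth B j.
Proof. exact: tnth_mktuple. Qed.

Lemma tnth_permute k (B : k.-tuple 'I_n) s j :
  tnth (permute B s) j = tnth B (s j).
Proof. exact: tnth_mktuple. Qed.

Lemma replace_cons0 k a (B : k.-tuple 'I_n) f :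
  replace (a ::: B) ord0 f = f ::: B.
Proof.
apply: eq_from_tnth => j; rewrite tnth_replace.
by case: (unliftP ord0 j) => [j'|] ->; rewrite ?tnth_consS ?tnth_cons0 ?eqxx.
Qed.

Lemma replace_consS k a (B : k.-tuple 'I_n) i f :
  replace (a ::: B) (lift ord0 i) f = a ::: replace B i f.
Proof.
apply: eq_from_tnth => j; rewrite tnth_replace.
case: (unliftP ord0 j) => [j'|] ->; rewrite ?tnth_consS ?tnth_cons0 ?eqxx//.
by rewrite tnth_replace (inj_eq lift_inj).
Qed.

Lemma replace_replace k (B : k.-tuple 'I_n) i f e :
  replace (replace B i f) i e = replace B i e.
Proof. by apply: eq_from_tnth => j; rewrite !tnth_replace; case: eqP. Qed.

Lemma replaceC k (B : k.-tuple 'I_n) i j f e : i != j ->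
  replace (replace B i f) j e = replace (replace B j e) i f.
Proof.
move=> ij; apply: eq_from_tnth => l; rewrite !tnth_replace.
by case: (eqVneq l j) => // ->; rewrite eq_sym (negbTE ij).
Qed.

Lemma replace_id k (B : k.-tuple 'I_n) i : replace B i (tnth B i) = B.
Proof.
by apply: eq_from_tnth => j; rewrite tnth_replace; case: eqP => // ->.
Qed.

Lemma replace_permute k (B : k.-tuple 'I_n) s i f :
  replace (permute B s) i f = permute (replace B (s i) f) s.
Proof.
apply: eq_from_tnth => j.
by rewrite tnth_permute !tnth_replace tnth_permute (inj_eq perm_inj).
Qed.

Lemma permute_permute k (B : k.-tuple 'I_n) s t :
  permute (permute B s) t = permute B (t * s)%g.
Proof. by apply: eq_from_tnth => j; rewrite !tnth_permute permM. Qed.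

End IndexStrings.

(** * The covariant derivative in coordinates *)

Section CovariantDerivative.
Variables (R : realType) (n : nat) (G : components R n 2).
Local Notation Gamma := (christoffel G).

Lemma covd_cons k (T : components R n k) x a (B : k.-tuple 'I_n) :
  covd G T x (a ::: B) = partial a (fun y => T y B) x
    - \sum_(i < k) \sum_(f < n) Gamma x f a (tnth B i) * T x (replace B i f).
Proof. by rewrite /covd theadE; congr (partial a _ x - _);
  rewrite (_ : [tuple of _] = B)//; exact: val_inj. Qed.

Lemma covd_near k (T T' : components R n k) x I :
  (\forall y \near x, T y = T' y) -> covd G T x I = covd G T' x I.
Proof.
move=> TT'; rewrite /covd (nbhs_singleton TT'); congr (_ - _).
by apply: partial_near; apply: filterS TT' => y ->.
Qed.

(** With [eps] the sign of [s], this transfers the skewness of [h] to the indices of its covariant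
    derivative after the first. The Christoffel terms match once the positions are reindexed by
    [s]. *)
Lemma covd_permute k (T : components R n k) (eps : R) (s : 'S_k) x a B :
  (forall I, pderivable (fun y => T y I) x) ->
  (\forall y \near x, forall I, T y (permute I s) = eps * T y I) ->
  covd G T x (a ::: permute B s) = eps * covd G T x (a ::: B).
Proof.
move=> dT sT; rewrite !covd_cons mulrBr; congr (_ - _).
  rewrite (@partial_near _ _ _ _ (fun y => eps * T y B)).
    rewrite partialM ?partial_cst ?mul0r ?addr0; [by []| |exact: dT].
    exact: pderivable_cst.
  by apply: filterS sT => y ->.
rewrite mulr_sumr [in RHS](reindex_inj (@perm_inj _ s)).
apply: eq_bigr => i _; rewrite mulr_sumr; apply: eq_bigr => f _.
by rewrite tnth_permute replace_permute (nbhs_singleton sT) mulrCA.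
Qed.

(** The coordinate expression of [R_{abd}^f], with the signs of the convention in which the
    commutator sends [V_d] to [R_{abd}^f V_f]. *)
Definition curv (x : 'rV[R]_n) (a b d f : 'I_n) : R :=
  - partial a (fun y => Gamma y f b d) x + partial b (fun y => Gamma y f a d) x
  + \sum_(e < n) Gamma x e a d * Gamma x f b e
  - \sum_(e < n) Gamma x e b d * Gamma x f a e.

Variable x : 'rV[R]_n.
Hypothesis Gamma_sym : forall c a b, Gamma x c a b = Gamma x c b a.
Hypothesis dGamma : forall c a b, pderivable (fun y => Gamma y c a b) x.

Section SecondDerivative.
Variables (k : nat) (T : components R n k).
Hypothesis dT : forall B, pderivable (fun y => T y B) x.
Hypothesis ddT : forall b B, pderivable (partial b (fun y => T y B)) x.

(** The terms in which two Christoffel symbols act on different positions. The two replacements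
    commute, so these terms are symmetric in [a] and [b] and leave the commutator. *)
Let quadratic a b (B : k.-tuple 'I_n) : R :=
  \sum_(i < k) \sum_(j < k | j != i) \sum_(f < n) \sum_(e < n)
    Gamma x f a (tnth B i) * Gamma x e b (tnth B j)
    * T x (replace (replace B i f) j e).

Let quadraticC a b B : quadratic a b B = quadratic b a B.
Proof.
rewrite /quadratic; move: (Gamma x) (T x) => C t.
rewrite (exchange_big_dep predT)//=; apply: eq_bigr => i _.
under eq_bigl do rewrite eq_sym.
apply: eq_bigr => j ij; rewrite exchange_big /=; apply: eq_bigr => f _.
apply: eq_bigr => e _; rewrite replaceC//.
by congr (_ * _); exact: mulrC.
Qed.

(** The grouping prepares the exchange of [a] and [b]: the second and third groups build [curv],
    while the last three are symmetric, the sum over [Gamma x f a b] because torsion vanishes. *)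
Lemma covd_covd a b B : covd G (covd G T) x (a ::: b ::: B) =
  partial a (partial b (fun y => T y B)) x
  - \sum_(i < k) \sum_(f < n)
      partial a (fun y => Gamma y f b (tnth B i)) x * T x (replace B i f)
  + \sum_(i < k) \sum_(f < n)
      (\sum_(e < n) Gamma x e a (tnth B i) * Gamma x f b e)
      * T x (replace B i f)
  - \sum_(f < n) Gamma x f a b * covd G T x (f ::: B)
  - (\sum_(i < k) \sum_(f < n)
       Gamma x f b (tnth B i) * partial a (fun y => T y (replace B i f)) x
     + \sum_(i < k) \sum_(f < n)
       Gamma x f a (tnth B i) * partial b (fun y => T y (replace B i f)) x)
  + quadratic a b B.
Proof.
rewrite covd_cons.
under eq_fun do rewrite covd_cons.
rewrite partialB; last 2 first.
- exact: ddT.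
- by apply: pderivable_sum => i; apply: pderivable_sum => f; apply: pderivableM.
rewrite partial_sum; last first.
  by move=> i; apply: pderivable_sum => f; apply: pderivableM.
under [in LHS]eq_bigr => i _.
  rewrite partial_sum; last by move=> f; apply: pderivableM.
  under eq_bigr do rewrite partialM// addrC.
  rewrite big_split /=; over.
rewrite big_split /= big_ord_recl.
have -> : \sum_(f < n) Gamma x f a (tnth (b ::: B) ord0)
      * covd G T x (replace (b ::: B) ord0 f)
    = \sum_(f < n) Gamma x f a b * covd G T x (f ::: B).
  by apply: eq_bigr => f _; rewrite replace_cons0.
have -> : \sum_(i < k) \sum_(f < n)
    Gamma x f a (tnth (b ::: B) (lift ord0 i))
    * covd G T x (replace (b ::: B) (lift ord0 i) f)
  = \sum_(i < k) \sum_(f < n)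
       Gamma x f a (tnth B i) * partial b (fun y => T y (replace B i f)) x
    - (\sum_(i < k) \sum_(f < n)
        (\sum_(e < n) Gamma x e a (tnth B i) * Gamma x f b e)
        * T x (replace B i f) + quadratic a b B).
  rewrite -big_split -sumrB /=; apply: eq_bigr => i _.
  under eq_bigr do rewrite tnth_consS replace_consS covd_cons mulrBr.
  rewrite sumrB; congr (_ - _).
  under [LHS]eq_bigr do rewrite mulr_sumr.
  (* The diagonal [j = i], where both symbols act on the same position, is the quadratic part of the
     curvature; the rest is [quadratic]. *)
  rewrite [LHS]exchange_big /= [LHS](bigD1 i)//=; congr (_ + _).
    under [LHS]eq_bigr do rewrite mulr_sumr.
    rewrite [LHS]exchange_big; apply: eq_bigr => e _.
    rewrite mulr_suml; apply: eq_bigr => f _.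
    by rewrite tnth_replace eqxx replace_replace mulrA.
  apply: eq_bigr => j ji; apply: eq_bigr => f _.
  rewrite mulr_sumr; apply: eq_bigr => e _.
  by rewrite tnth_replace (negbTE ji) mulrA.
by ring.
Qed.

(** The commutator of partial derivatives is kept here; it is shown to vanish later, from the
    defining property of the Riemann tensor. *)
Lemma covd_comm a b B :
  covd G (covd G T) x (a ::: b ::: B) - covd G (covd G T) x (b ::: a ::: B) =
  (partial a (partial b (fun y => T y B)) x
   - partial b (partial a (fun y => T y B)) x)
  + \sum_(i < k) \sum_(f < n) curv x a b (tnth B i) f * T x (replace B i f).
Proof.
pose A a' b' : R := \sum_(i < k) \sum_(f < n)
  partial a' (fun y => Gamma y f b' (tnth B i)) x * T x (replace B i f).
pose D a' b' : R := \sum_(i < k) \sum_(f < n)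
  (\sum_(e < n) Gamma x e a' (tnth B i) * Gamma x f b' e)
  * T x (replace B i f).
pose P a' b' : R := \sum_(i < k) \sum_(f < n)
  Gamma x f b' (tnth B i) * partial a' (fun y => T y (replace B i f)) x.
have -> : \sum_(i < k) \sum_(f < n)
    curv x a b (tnth B i) f * T x (replace B i f)
    = - A a b + A b a + D a b - D b a.
  rewrite -!sumrN -!big_split /=; apply: eq_bigr => i _.
  rewrite -!sumrN -!big_split /=; apply: eq_bigr => f _.
  by rewrite /curv !mulrDl !mulNr.
have -> : covd G (covd G T) x (b ::: a ::: B) =
    partial b (partial a (fun y => T y B)) x - A b a + D b a
    - \sum_(f < n) Gamma x f a b * covd G T x (f ::: B)
    - (P b a + P a b) + quadratic a b B.
  rewrite covd_covd (quadraticC b a) -/(A b a) -/(D b a) -/(P a b) -/(P b a).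
  by under [X in _ - X - _ + _]eq_bigr do rewrite Gamma_sym.
rewrite covd_covd -/(A a b) -/(D a b) -/(P a b) -/(P b a).
move: (A a b) (A b a) (D a b) (D b a) (P a b) (P b a) (quadratic a b B).
move: (partial a _ _) (partial b _ _) (\sum_(f < n) _ * _).
move=> u v w A1 A2 D1 D2 P1 P2 q.
ring.
Qed.

End SecondDerivative.

End CovariantDerivative.

(** * Metric compatibility and torsion *)

Section TensorCalculus.
Variables (R : realType) (n : nat) (G : components R n 2).

Definition select k l (I : k.-tuple 'I_n) (sigma : 'I_l -> 'I_k) :
  l.-tuple 'I_n := [tuple tnth I (sigma j) | j < l].

Lemma tnth_select k l (I : k.-tuple 'I_n) (sigma : 'I_l -> 'I_k) j :
  tnth (select I sigma) j = tnth I (sigma j).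
Proof. exact: tnth_mktuple. Qed.

Lemma select_replace k l (I : k.-tuple 'I_n) (sigma : 'I_l -> 'I_k) j f :
  injective sigma ->
  select (replace I (sigma j) f) sigma = replace (select I sigma) j f.
Proof.
move=> inj; apply: eq_from_tnth => i.
by rewrite tnth_select !tnth_replace tnth_select (inj_eq inj).
Qed.

Lemma select_replace_out k l (I : k.-tuple 'I_n) (sigma : 'I_l -> 'I_k) i f :
  (forall j, sigma j != i) -> select (replace I i f) sigma = select I sigma.
Proof.
move=> out; apply: eq_from_tnth => j.
by rewrite !tnth_select tnth_replace (negbTE (out j)).
Qed.

(* The map [sigma] says which factor of the tensor product each index of the
   product belongs to, and where. *)
Lemma covd_prod k1 k2 k (T1 : components R n k1) (T2 : components R n k2)
    (sigma : 'I_k1 + 'I_k2 -> 'I_k) x a I : bijective sigma ->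
  (forall J, pderivable (fun y => T1 y J) x) ->
  (forall J, pderivable (fun y => T2 y J) x) ->
  let s1 := sigma \o inl in let s2 := sigma \o inr in
  covd G (fun y J => T1 y (select J s1) * T2 y (select J s2)) x (a ::: I)
  = covd G T1 x (a ::: select I s1) * T2 x (select I s2)
    + T1 x (select I s1) * covd G T2 x (a ::: select I s2).
Proof.
move=> bij dT1 dT2 s1 s2; have inj := bij_inj bij.
have inj1 : injective s1 by move=> i j /inj [].
have inj2 : injective s2 by move=> i j /inj [].
rewrite !covd_cons partialM// (reindex sigma) /=; last exact: onW_bij.
rewrite big_sumType /=.
have -> : \sum_(i < k1) \sum_(f < n) christoffel G x f a (tnth I (sigma (inl i)))
    * (T1 x (select (replace I (sigma (inl i)) f) s1)
       * T2 x (select (replace I (sigma (inl i)) f) s2))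
  = (\sum_(i < k1) \sum_(f < n) christoffel G x f a (tnth (select I s1) i)
      * T1 x (replace (select I s1) i f)) * T2 x (select I s2).
  rewrite mulr_suml; apply: eq_bigr => i _.
  rewrite mulr_suml; apply: eq_bigr => f _.
  rewrite (select_replace _ i)// select_replace_out; last first.
    by move=> j; apply/eqP => /inj.
  by rewrite tnth_select mulrA.
have -> : \sum_(i < k2) \sum_(f < n) christoffel G x f a (tnth I (sigma (inr i)))
    * (T1 x (select (replace I (sigma (inr i)) f) s1)
       * T2 x (select (replace I (sigma (inr i)) f) s2))
  = T1 x (select I s1) *
    (\sum_(i < k2) \sum_(f < n) christoffel G x f a (tnth (select I s2) i)
      * T2 x (replace (select I s2) i f)).
  rewrite mulr_sumr; apply: eq_bigr => i _.
  rewrite mulr_sumr; apply: eq_bigr => f _.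
  rewrite (select_replace _ i)// select_replace_out; last first.
    by move=> j; apply/eqP => /inj.
  by rewrite tnth_select mulrCA.
set X1 := \sum_(i < k1) _; set X2 := \sum_(i < k2) _.
move: X1 X2 (T1 x _) (T2 x _) (partial a _ x) (partial a _ x).
by move=> X1 X2 t1 t2 p1 p2; ring.
Qed.

Lemma covd_lincomb (S : finType) k (w : S -> R) (T : S -> components R n k)
    x a I : (forall s J, pderivable (fun y => T s y J) x) ->
  covd G (fun y J => \sum_s w s * T s y J) x (a ::: I)
  = \sum_s w s * covd G (T s) x (a ::: I).
Proof.
move=> dT; rewrite covd_cons partial_sum; last first.
  by move=> s; apply: pderivableM => //; exact: pderivable_cst.
under eq_bigr => s _.
  rewrite partialM; [|exact: pderivable_cst|exact: dT].
  rewrite partial_cst mul0r addr0; over.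
under [X in _ - X]eq_bigr => i _.
  under eq_bigr do rewrite mulr_sumr; rewrite exchange_big /=; over.
rewrite [X in _ - X]exchange_big -sumrB; apply: eq_bigr => s _.
rewrite covd_cons mulrBr; congr (_ - _).
rewrite mulr_sumr; apply: eq_bigr => i _.
by rewrite mulr_sumr; apply: eq_bigr => f _; rewrite mulrCA.
Qed.

Lemma covd_cst0 k x I : covd G (fun _ (_ : k.-tuple 'I_n) => 0) x I = 0.
Proof.
rewrite /covd partial_cst sub0r big1 ?oppr0// => i _.
by rewrite big1// => f _; rewrite mulr0.
Qed.

End TensorCalculus.

(** * The Levi-Civita connection in one chart *)

Section LocalMetric.
Variables (R : realType) (n : nat) (G : components R n 2) (U : set 'rV[R]_n).
Hypothesis U_open : open U.
Hypothesis G_smooth : forall I, smooth_on U (fun y => G y I).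
Hypothesis G_sym :
  forall y, U y -> forall a b, G y [tuple a; b] = G y [tuple b; a].
Hypothesis G_unit :
  forall y, U y -> \matrix_(a, b) G y [tuple a; b] \in unitmx.
Local Notation Gamma := (christoffel G).

Lemma near_chart (P : set 'rV[R]_n) x :
  U x -> (forall y, U y -> P y) -> \forall y \near x, P y.
Proof. by move=> Ux UP; apply: filterS UP _; exact: open_nbhs_nbhs. Qed.

Lemma metric_invK y a c : U y ->
  \sum_(f < n) G y [tuple a; f] * metric_inv G y f c = (a == c)%:R.
Proof.
move=> Uy; have /matrixP /(_ a c) := mulmxV (G_unit Uy).
by rewrite !mxE => <-; apply: eq_bigr => f _; rewrite !mxE.
Qed.

Lemma metric_inv_sym y a b : U y -> metric_inv G y a b = metric_inv G y b a.
Proof.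
move=> Uy; rewrite /metric_inv; set M := \matrix_(i, j) _.
suff MT : M^T = M by rewrite -[in LHS]MT -trmx_inv mxE.
by apply/matrixP => i j; rewrite !mxE G_sym.
Qed.

Lemma christoffel_sym y c a b : U y -> Gamma y c a b = Gamma y c b a.
Proof.
move=> Uy; rewrite /christoffel; congr (_ * _); apply: eq_bigr => d _.
congr (_ * _); rewrite [X in X - _]addrC; congr (_ - _).
by apply: partial_near; apply: near_chart => // z Uz; rewrite G_sym.
Qed.

Lemma pderivable_metric x I : U x -> pderivable (fun y => G y I) x.
Proof. exact: smooth_pderivable. Qed.

Lemma pderivable_christoffel x c a b :
  U x -> pderivable (fun y => Gamma y c a b) x.
Proof.
move=> Ux; have dG i I : pderivable (partial i (fun y => G y I)) x.
  exact: (smooth_pderivable (smooth_partial _ (G_smooth I))).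
apply: pderivableM; first exact: pderivable_cst.
apply: pderivable_sum => d; apply: pderivableM.
  apply: pderivable_invmx; first by apply: near_chart.
  move=> i j; rewrite (_ : (fun _ => _) = fun y => G y [tuple i; j]).
    exact: pderivable_metric.
  by apply/funext => y; rewrite mxE.
by apply: pderivableB; [apply: pderivableD|].
Qed.

Lemma christoffel_lower x a b c : U x ->
  \sum_(f < n) Gamma x f a b * G x [tuple f; c] =
  2^-1 * (partial a (fun y => G y [tuple b; c]) x
          + partial b (fun y => G y [tuple a; c]) x
          - partial c (fun y => G y [tuple a; b]) x).
Proof.
move=> Ux; rewrite /christoffel.
pose D d : R := partial a (fun y => G y [tuple b; d]) x
  + partial b (fun y => G y [tuple a; d]) x
  - partial d (fun y => G y [tuple a; b]) x.
rewrite -/(D c); under eq_bigr do rewrite -mulrA mulr_suml.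
rewrite -mulr_sumr exchange_big; congr (_ * _).
transitivity (\sum_(d < n) (c == d)%:R * D d); last first.
  rewrite (bigD1 c)//= eqxx mul1r big1 ?addr0// => d /negbTE.
  by rewrite eq_sym => ->; rewrite mul0r.
apply: eq_bigr => d _; rewrite -(metric_invK _ _ Ux) mulr_suml.
by apply: eq_bigr => f _; rewrite (G_sym Ux f c) mulrC mulrA.
Qed.

Lemma pair_tuple (J : 2.-tuple 'I_n) :
  J = [tuple tnth J ord0; tnth J (lift ord0 ord0)].
Proof.
apply: eq_from_tnth => i; case: (unliftP ord0 i) => [j|] ->//.
by rewrite (ord1 j).
Qed.

(** The two lowered Christoffel symbols, given by the Koszul formula, add up to the partial
    derivative of the metric. *)
Lemma covd_metric x I : U x -> covd G G x I = 0.
Proof.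
move=> Ux; case/tupleP: I => a J; rewrite -[LHS]/(covd G G x (a ::: J)).
rewrite covd_cons (pair_tuple J); set b := tnth J ord0; set c := tnth J _.
rewrite big_ord_recl big_ord1.
have -> : \sum_(f < n) Gamma x f a (tnth [tuple b; c] ord0)
    * G x (replace [tuple b; c] ord0 f)
  = \sum_(f < n) Gamma x f a b * G x [tuple f; c].
  apply: eq_bigr => f _; congr (_ * G x _).
  by rewrite [LHS]pair_tuple !tnth_replace.
have -> : \sum_(f < n) Gamma x f a (tnth [tuple b; c] (lift ord0 ord0))
    * G x (replace [tuple b; c] (lift ord0 ord0) f)
  = \sum_(f < n) Gamma x f a c * G x [tuple f; b].
  apply: eq_bigr => f _; rewrite (G_sym Ux f b); congr (_ * G x _).
  by rewrite [LHS]pair_tuple !tnth_replace.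
rewrite !christoffel_lower//.
rewrite (@partial_near _ _ a (fun y => G y [tuple c; b])
  (fun y => G y [tuple b; c])); last first.
  by apply: near_chart => // z Uz; rewrite G_sym.
move: (partial _ _ _) (partial _ _ _) (partial _ _ _) => p q r.
by field.
Qed.

(** Symmetry of the Christoffel symbols makes the terms of the cyclic sum cancel in pairs. *)
Lemma curv_bianchi x a b d f : U x ->
  curv G x a b d f + curv G x b d a f + curv G x d a b f = 0.
Proof.
move=> Ux; rewrite /curv.
have S i e j k : partial i (fun y => Gamma y e j k) x
    = partial i (fun y => Gamma y e k j) x.
  by apply: partial_near; apply: near_chart => // z Uz; rewrite christoffel_sym.
have C i j k : \sum_(e < n) Gamma x e i j * Gamma x f k e
    = \sum_(e < n) Gamma x e j i * Gamma x f k e.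
  by apply: eq_bigr => e _; rewrite (christoffel_sym _ _ j).
rewrite (S a f d b) (S b f d a) (S d f b a) (C d a) (C d b) (C b a).
do 3!move: (\sum_(e < n) _) => ?; do 3!move: (partial _ _ _) => ?.
by ring.
Qed.

End LocalMetric.

(** * The Riemann tensor *)

(** The octahedron argument: each of the four entries takes its turn in the last slot of the cyclic
    identity, skewness normalizes the twelve terms, and a linear combination leaves the claim. *)
Lemma pair_symmetry (R : realFieldType) (I : Type) (Q : I -> I -> I -> I -> R) :
  (forall a b c d, Q a b c d = - Q b a c d) ->
  (forall a b c d, Q a b c d = - Q a b d c) ->
  (forall a b c d, Q a b c d + Q b c a d + Q c a b d = 0) ->
  forall a b c d, Q a b c d = Q c d a b.
Proof.
move=> s12 s34 cyc a b c d.
have := (cyc a b c d, cyc b c d a, cyc c d a b, cyc d a b c).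
rewrite (s34 b c d a) (s34 c d b a) (s12 d b c a).
rewrite (s12 d a c b) (s34 a d c b) (s12 a c d b) (s34 c a d b).
rewrite (s12 d a b c) (s34 a b d c) (s34 b d a c).
by move=> [[[]]] *; lra.
Qed.

Section Riemann.
Variables (R : realType) (n : nat) (G : components R n 2) (U : set 'rV[R]_n).
Hypothesis U_open : open U.
Hypothesis G_smooth : forall I, smooth_on U (fun y => G y I).
Hypothesis G_sym :
  forall y, U y -> forall a b, G y [tuple a; b] = G y [tuple b; a].
Hypothesis G_unit :
  forall y, U y -> \matrix_(a, b) G y [tuple a; b] \in unitmx.
Variable Rm : 'rV[R]_n -> 'I_n -> 'I_n -> 'I_n -> 'I_n -> R.
Hypothesis Rm_riemann : forall V : components R n 1,
  (forall I, smooth_on U (fun y => V y I)) ->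
  forall x, U x -> forall a b d,
    covd G (covd G V) x [tuple a; b; d] - covd G (covd G V) x [tuple b; a; d]
    = \sum_(f < n) Rm x a b d f * V x [tuple f].

Variable x : 'rV[R]_n.
Hypothesis Ux : U x.

Let Gamma_sym c a b : christoffel G x c a b = christoffel G x c b a.
Proof. exact: (christoffel_sym U_open). Qed.

Let dGamma c a b : pderivable (fun y => christoffel G y c a b) x.
Proof. exact: (pderivable_christoffel U_open). Qed.

(* Testing the Riemann tensor on the covector fields [phi dx^e]: [phi = 1]
   identifies it with [curv], and any other [phi] then shows that second
   partial derivatives commute, so that Schwarz' theorem is not needed. *)
Lemma riemann_test (phi : 'rV[R]_n -> R) a b d e : smooth_on U phi ->
  (if d == e then partial a (partial b phi) x - partial b (partial a phi) x
   else 0) + curv G x a b d e * phi x = Rm x a b d e * phi x.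
Proof.
move=> sphi; pose V : components R n 1 :=
  fun y I => if thead I == e then phi y else 0.
have sV I : smooth_on U (fun y => V y I).
  by rewrite /V; case: eqP => // _; exact: smooth_cst.
have pick (F : 'I_n -> R) : \sum_(f < n) F f * (if f == e then phi x else 0)
    = F e * phi x.
  rewrite (bigD1 e)//= eqxx big1 ?addr0// => f /negbTE ->.
  by rewrite mulr0.
have := Rm_riemann sV Ux a b d; rewrite [RHS]pick => <-.
have := @covd_comm _ _ G x Gamma_sym dGamma _ V
  (fun B => smooth_pderivable (sV B) Ux)
  (fun b B => smooth_pderivable (smooth_partial b (sV B)) Ux) a b [tuple d].
rewrite big_ord1 => /esym; congr (_ + _ = _).
  rewrite /V; case: eqP => // _.
  rewrite (_ : partial b _ = fun=> 0) 1?(_ : partial a _ = fun=> 0);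
    do ?by apply/funext => y; rewrite partial_cst.
  by rewrite !partial_cst subrr.
rewrite -(pick (curv G x a b d)); apply: eq_bigr => f _; congr (_ * _).
by rewrite /V /thead tnth_replace.
Qed.

Lemma riemann_curv a b d e : Rm x a b d e = curv G x a b d e.
Proof.
have := riemann_test a b d e (smooth_cst U 1); rewrite !mulr1 => <-.
rewrite (_ : partial b _ = fun=> 0) 1?(_ : partial a (fun=> 1) = fun=> 0);
  do ?by apply/funext => y; rewrite partial_cst.
by rewrite !partial_cst subrr if_same add0r.
Qed.

Lemma partialC (phi : 'rV[R]_n -> R) a b : smooth_on U phi ->
  partial a (partial b phi) x = partial b (partial a phi) x.
Proof.
move=> sphi; have := riemann_test a b a a sphi.
rewrite eqxx -riemann_curv => E.
by apply/subr0_eq/(addIr (Rm x a b a a * phi x)); rewrite E add0r.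
Qed.

Lemma ricci_identity k (T : components R n k) a b B :
  (forall I, smooth_on U (fun y => T y I)) ->
  covd G (covd G T) x (a ::: b ::: B) - covd G (covd G T) x (b ::: a ::: B)
  = \sum_(i < k) \sum_(f < n) Rm x a b (tnth B i) f * T x (replace B i f).
Proof.
move=> sT; rewrite covd_comm//; first last.
- by move=> c I; exact: smooth_pderivable (smooth_partial _ (sT I)) Ux.
- by move=> I; exact: smooth_pderivable (sT I) Ux.
rewrite partialC// subrr add0r; apply: eq_bigr => i _.
by apply: eq_bigr => f _; rewrite riemann_curv.
Qed.

(** Convertible to [riem_down], but stated for bare component functions in one chart. *)
Definition lower (a b d f : 'I_n) : R :=
  \sum_(e < n) Rm x a b d e * G x [tuple e; f].

Lemma lower_skew12 a b d f : lower a b d f = - lower b a d f.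
Proof.
rewrite /lower -sumrN; apply: eq_bigr => e _.
rewrite -mulNr; congr (_ * _); rewrite !riemann_curv /curv.
do 2!move: (\sum_(i < n) _) => ?; do 2!move: (partial _ _ _) => ?.
by ring.
Qed.

(** This is the Ricci identity for the metric itself, whose covariant derivative vanishes on all of
    [U] and can therefore be differentiated again. *)
Lemma lower_skew34 a b d f : lower a b d f = - lower a b f d.
Proof.
have := ricci_identity a b [tuple d; f] G_smooth.
have covd0 I : covd G (covd G G) x I = 0.
  rewrite (@covd_near _ _ _ _ _ (fun _ _ => 0)) ?covd_cst0//.
  apply: (near_chart U_open) => // y Uy; apply/funext => J.
  exact: (covd_metric U_open).
rewrite !covd0 subrr big_ord_recl big_ord1 => /esym/eqP.
rewrite addr_eq0 => /eqP H; rewrite /lower.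
transitivity (\sum_(e < n) Rm x a b (tnth [tuple d; f] ord0) e
  * G x (replace [tuple d; f] ord0 e)).
  apply: eq_bigr => e _; congr (_ * G x _).
  by rewrite [RHS]pair_tuple !tnth_replace.
rewrite H; congr (- _); apply: eq_bigr => e _; congr (_ * _).
rewrite [RHS]G_sym//; congr (G x _).
by rewrite [LHS]pair_tuple !tnth_replace.
Qed.

Lemma lower_bianchi a b c d : lower a b c d + lower b c a d + lower c a b d = 0.
Proof.
rewrite /lower -!big_split big1//= => e _.
by rewrite -!mulrDl !riemann_curv (curv_bianchi U_open) ?mul0r.
Qed.

Lemma lower_pair a b c d : lower a b c d = lower c d a b.
Proof.
exact: (pair_symmetry lower_skew12 lower_skew34 lower_bianchi).
Qed.

End Riemann.

(** * Antisymmetrization *)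

Section Antisymmetrization.
Variables (R : realType) (n : nat).

Definition alternating k (F : k.-tuple 'I_n -> R) : Prop :=
  forall I s, F (permute I s) = (-1) ^+ s * F I.

Lemma antisym_ext k (F F' : k.-tuple 'I_n -> R) I :
  F =1 F' -> antisym F I = antisym F' I.
Proof.
by move=> FF'; congr (_ * _); apply: eq_bigr => s _; rewrite FF'.
Qed.

(** The two sides differ by a conjugation of the summation variable, which preserves signs. *)
Lemma antisym_permute k (F : k.-tuple 'I_n -> R) I (r : 'S_k) :
  antisym F (permute I r) = antisym (fun J => F (permute J r)) I.
Proof.
rewrite /antisym; congr (_ * _); rewrite (reindex_inj (@conjg_inj _ r^-1%g)) /=.
apply: eq_bigr => s _; rewrite odd_permJ !permute_permute.
congr (_ * F (permute I _)).
by rewrite conjgE invgK mulgA mulgKV.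
Qed.

Lemma alternating_swap k (F : k.+1.-tuple 'I_n -> R) c (J : k.-tuple 'I_n) i f :
  alternating F -> F (c ::: replace J i f) = - F (f ::: replace J i c).
Proof.
move=> altF; have := altF (f ::: replace J i c) (tperm ord0 (lift ord0 i)).
rewrite odd_tperm neq_lift expr1 mulN1r => <-; congr F.
apply: eq_from_tnth => j; rewrite tnth_permute.
case: (unliftP ord0 j) => [l|] ->.
  rewrite tnth_consS tnth_replace; case: (eqVneq l i) => [->|li].
    by rewrite tpermR tnth_cons0.
  rewrite tpermD ?neq_lift ?(inj_eq lift_inj) 1?eq_sym//.
  by rewrite tnth_consS tnth_replace (negbTE li).
by rewrite tpermL tnth_consS tnth_replace eqxx.
Qed.

Lemma alternating_swap2 k (F : k.+2.-tuple 'I_n -> R) c d (E : k.-tuple 'I_n) :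
  alternating F -> F (c ::: d ::: E) = - F (d ::: c ::: E).
Proof.
move=> altF; have := alternating_swap c (c ::: E) ord0 d altF.
by rewrite !replace_cons0.
Qed.

Lemma lift_perm_surj k (t : 'S_k.+1) :
  t ord0 = ord0 -> exists s, t = lift_perm ord0 ord0 s.
Proof.
move=> t0; have tl j : {i | t (lift ord0 j) = lift ord0 i}.
  case: (unliftP ord0 (t (lift ord0 j))) => [i ->|]; first by exists i.
  by rewrite -[in RHS]t0 => /perm_inj /eqP;
    rewrite eq_sym (negbTE (neq_lift _ _)).
have inj : injective (fun j => sval (tl j)).
  move=> i j /(congr1 (lift ord0)); case: (tl i) (tl j) => [? <-] [? <-] /=.
  by move=> /perm_inj /lift_inj.
exists (perm inj); apply/permP => j; case: (unliftP ord0 j) => [i|] ->.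
  by rewrite lift_perm_lift permE; case: (tl i).
by rewrite lift_perm_id.
Qed.

Lemma permute_lift k c (J : k.-tuple 'I_n) s :
  permute (c ::: J) (lift_perm ord0 ord0 s) = c ::: permute J s.
Proof.
apply: eq_from_tnth => j; rewrite tnth_permute.
case: (unliftP ord0 j) => [i|] ->.
  by rewrite lift_perm_lift !tnth_consS tnth_permute.
by rewrite lift_perm_id !tnth_cons0.
Qed.

(** In place of counting the permutations with a given image of [ord0], the sum is averaged over all
    positions: for a fixed [s], the sum over positions is a reordering of that of [v]. *)
Lemma sum_perm_image k (v : 'I_k.+1 -> R) :
  \sum_(s : 'S_k.+1) v (s ord0) = k`!%:R * \sum_j v j.
Proof.
have avg j : \sum_(s : 'S_k.+1) v (s ord0) = \sum_(s : 'S_k.+1) v (s j).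
  rewrite (reindex_inj (mulgI (tperm j ord0))) /=.
  by apply: eq_bigr => s _; rewrite permM tpermR.
have k0 : k.+1%:R != 0 :> R by rewrite pnatr_eq0.
apply: (mulfI k0); rewrite mulrA -natrM -factS.
have -> : k.+1%:R * \sum_(s : 'S_k.+1) v (s ord0)
    = \sum_(j < k.+1) \sum_(s : 'S_k.+1) v (s j).
  rewrite -(eq_bigr _ (fun j _ => avg j)) sumr_const card_ord.
  by rewrite mulr_natl.
rewrite exchange_big /= (eq_bigr (fun=> \sum_j v j)); last first.
  by move=> s _; rewrite [RHS](reindex_inj (@perm_inj _ s)).
by rewrite sumr_const card_Sn mulr_natl.
Qed.

(** As [F] is skew, a summand depends only on which entry reaches [u]. Each entry does so for [k!]
    permutations, whence the weight [k! / (k+1)!]. *)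
Lemma antisym_cons k (u : 'I_n -> R) (F : k.-tuple 'I_n -> R) c J :
  alternating F ->
  antisym (fun I : k.+1.-tuple 'I_n => u (thead I) * F (behead_tuple I))
    (c ::: J)
  = k.+1%:R^-1 * (u c * F J - \sum_(i < k) u (tnth J i) * F (replace J i c)).
Proof.
move=> altF; rewrite /antisym.
pose T (I : k.+1.-tuple 'I_n) := u (thead I) * F (behead_tuple I).
pose v i := (-1) ^+ (tperm ord0 i : 'S_k.+1)
  * T (permute (c ::: J) (tperm ord0 i)).
have Tfix I (t : 'S_k.+1) : t ord0 = ord0 -> T (permute I t) = (-1) ^+ t * T I.
  move=> /lift_perm_surj [s ->]; case/tupleP: I => a I.
  rewrite permute_lift /T !theadE -[[tuple of _]]/(a ::: I) !behead_cons.
  by rewrite altF odd_lift_perm mulrCA.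
have vE (s : 'S_k.+1) : (-1) ^+ s * T (permute (c ::: J) s) = v (s ord0).
  rewrite /v; set tau := tperm _ _.
  (* The factor [s * tau] fixes [ord0], so it only permutes the arguments of [F] and contributes its
     sign; the transposition [tau] remains. *)
  have E : s = (s * tau * tau)%g by rewrite -mulgA tperm2 mulg1.
  rewrite [in permute _ s]E -permute_permute Tfix; last by rewrite permM tpermR.
  by rewrite mulrA -signr_addb odd_permM addKb.
rewrite (eq_bigr (fun s : 'S_k.+1 => v (s ord0)) (fun s _ => vE s)).
rewrite sum_perm_image mulrA factS natrM.
have k0 : k`!%:R != 0 :> R by rewrite pnatr_eq0 -lt0n fact_gt0.
rewrite invfM mulfVK//; congr (_ * _).
rewrite big_ord_recl /v tperm1 odd_perm1 mul1r; congr (_ + _).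
  rewrite (_ : permute _ _ = c ::: J) ?/T ?theadE ?behead_cons//.
  by apply: eq_from_tnth => j; rewrite tnth_permute perm1.
rewrite -sumrN; apply: eq_bigr => i _.
rewrite odd_tperm neq_lift expr1 mulN1r; congr (- _).
rewrite (_ : permute _ _ = tnth J i ::: replace J i c).
  by rewrite /T theadE behead_cons.
apply: eq_from_tnth => j; rewrite tnth_permute.
case: (unliftP ord0 j) => [l|] ->.
  rewrite tnth_consS tnth_replace; case: (eqVneq l i) => [->|li].
    by rewrite tpermR tnth_cons0.
  by rewrite tpermD ?neq_lift ?(inj_eq lift_inj) 1?eq_sym// tnth_consS.
by rewrite tpermL tnth_consS tnth_cons0.
Qed.

(** The index of [g] moves from last to first, as [antisym_cons] requires. The cyclic shift [ordS]
    acts on the string and on the slots at once, so no sign appears. *)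
Lemma hp_g_antisymE m (hp : m.+2.-tuple 'I_n -> R) (gx : 2.-tuple 'I_n -> R)
    a b d (E : m.-tuple 'I_n) e :
  hp_g_antisym hp gx a b d E e =
  antisym (fun I : m.+2.-tuple 'I_n =>
    gx [tuple thead I; b] * hp (a ::: behead_tuple I)) (e ::: d ::: E).
Proof.
have inj : injective (@ordS m.+2) by exact: ordS_inj.
have ordS_widen (j : 'I_m.+1) : ordS (widen_ord (leqnSn m.+1) j) = lift ord0 j.
  by apply: val_inj; rewrite /= modn_small// ltnS.
have ordS_max : ordS (ord_max : 'I_m.+2) = ord0.
  by apply: val_inj; rewrite /= modnn.
rewrite /hp_g_antisym.
rewrite (_ : [tuple of rcons _ _] = permute (e ::: d ::: E) (perm inj)).
  rewrite antisym_permute; apply: antisym_ext => I; rewrite mulrC.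
  congr (gx _ * hp _).
    by rewrite /last_index tnth_permute permE ordS_max.
  rewrite -[[tuple of _]]/(a ::: init_indices (permute I (perm inj))).
  congr (_ ::: _); apply: eq_from_tnth => j.
  rewrite tnth_mktuple tnth_permute permE ordS_widen.
  by case/tupleP: I => i I; rewrite -[[tuple of _]]/(i ::: I)
    behead_cons tnth_consS.
apply: eq_from_tnth => j; rewrite tnth_permute permE.
have [jm|jm] := ltnP j m.+1.
  have -> : j = widen_ord (leqnSn m.+1) (Ordinal jm) by exact: val_inj.
  rewrite ordS_widen tnth_consS !(tnth_nth e) /= -rcons_cons nth_rcons /=.
  by rewrite size_tuple jm.
have -> : j = ord_max.
  by apply/val_inj/eqP; rewrite eqn_leq jm andbT -ltnS ltn_ord.
rewrite ordS_max tnth_cons0 (tnth_nth e) /= nth_rcons.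
by rewrite size_tuple ltnn eqxx.
Qed.

End Antisymmetrization.

(** * Contraction of the integrability condition *)

Section Contraction.
Variables (R : realType) (n : nat).
Variables (g gi : 'I_n -> 'I_n -> R).
Hypothesis g_sym : forall a b, g a b = g b a.
Hypothesis gi_sym : forall a b, gi a b = gi b a.
Hypothesis giK : forall a c, \sum_f gi a f * g f c = (a == c)%:R.

Variable Q : 'I_n -> 'I_n -> 'I_n -> 'I_n -> R.
Hypothesis Q_skew34 : forall a b c d, Q a b c d = - Q a b d c.
Hypothesis Q_skew12 : forall a b c d, Q a b c d = - Q b a c d.
Hypothesis Q_pair : forall a b c d, Q a b c d = Q c d a b.
Hypothesis Q_bianchi :
  forall a b c d, Q a b c d + Q b c a d + Q c a b d = 0.

(** All raised indices are encoded by this contraction with the inverse metric. *)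
Definition tr2 (F : 'I_n -> 'I_n -> R) := \sum_a \sum_d gi a d * F a d.

Lemma eq_tr2 F F' : (forall a d, F a d = F' a d) -> tr2 F = tr2 F'.
Proof.
by move=> FF'; do 2!(apply: eq_bigr => ? _); rewrite FF'.
Qed.

Lemma tr2D F F' : tr2 (fun a d => F a d + F' a d) = tr2 F + tr2 F'.
Proof.
rewrite -big_split; apply: eq_bigr => a _; rewrite -big_split.
by apply: eq_bigr => d _; rewrite mulrDr.
Qed.

Lemma tr2N F : tr2 (fun a d => - F a d) = - tr2 F.
Proof.
rewrite -sumrN; apply: eq_bigr => a _; rewrite -sumrN.
by apply: eq_bigr => d _; rewrite mulrN.
Qed.

Lemma tr2Z r F : tr2 (fun a d => r * F a d) = r * tr2 F.
Proof.
rewrite mulr_sumr; apply: eq_bigr => a _; rewrite mulr_sumr.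
by apply: eq_bigr => d _; rewrite mulrCA.
Qed.

Lemma tr2_sum (I : finType) (F : I -> 'I_n -> 'I_n -> R) :
  tr2 (fun a d => \sum_i F i a d) = \sum_i tr2 (F i).
Proof.
rewrite exchange_big; apply: eq_bigr => a _; rewrite exchange_big.
by apply: eq_bigr => d _; rewrite mulr_sumr.
Qed.

Lemma tr2C F : tr2 F = tr2 (fun a d => F d a).
Proof.
rewrite /tr2 exchange_big; do 2!(apply: eq_bigr => ? _).
by rewrite gi_sym.
Qed.

Lemma tr2_skew F : (forall a d, F a d = - F d a) -> tr2 F = 0.
Proof.
move=> sF; have : tr2 F = - tr2 F by rewrite {2}tr2C -tr2N; exact: eq_tr2.
by move=> ?; lra.
Qed.

Lemma tr2_metric : tr2 g = n%:R.
Proof.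
rewrite /tr2; under eq_bigr => a _.
  under eq_bigr => d _ do rewrite (g_sym a).
  rewrite giK eqxx; over.
by rewrite sumr_const card_ord.
Qed.

Lemma tr2_metricl x (F : 'I_n -> R) : tr2 (fun a d => g a x * F d) = F x.
Proof.
have gx d : \sum_a gi a d * (g a x * F d) = (d == x)%:R * F d.
  by rewrite -giK mulr_suml; apply: eq_bigr => a _; rewrite gi_sym mulrA.
rewrite /tr2 exchange_big (bigD1 x)//= gx eqxx mul1r big1 ?addr0//.
by move=> d /negbTE dx; rewrite gx dx mul0r.
Qed.

Lemma exchange_tr2 (F : 'I_n -> 'I_n -> 'I_n -> 'I_n -> R) :
  tr2 (fun a d => tr2 (F a d)) = tr2 (fun b c => tr2 (fun a d => F a d b c)).
Proof.
rewrite /tr2.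
transitivity (\sum_a \sum_d \sum_b \sum_c gi a d * (gi b c * F a d b c)).
  do 2!(apply: eq_bigr => ? _); rewrite mulr_sumr.
  by apply: eq_bigr => ? _; rewrite mulr_sumr.
transitivity (\sum_b \sum_c \sum_a \sum_d gi a d * (gi b c * F a d b c)).
  under eq_bigr => a _ do rewrite exchange_big /=.
  rewrite exchange_big; apply: eq_bigr => b _ /=.
  under eq_bigr => a _ do rewrite exchange_big /=.
  by rewrite exchange_big.
do 2!(apply: eq_bigr => ? _); rewrite mulr_sumr.
by apply: eq_bigr => ? _; rewrite mulr_sumr; apply: eq_bigr => ? _;
  rewrite mulrCA.
Qed.

Lemma Q_bianchi3 a b c d : Q a b c d + Q a c d b + Q a d b c = 0.
Proof.
rewrite (Q_pair a b c d) (Q_pair a c d b) (Q_pair a d b c).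
have := Q_bianchi b c d a.
rewrite (Q_skew34 c d a b) (Q_skew34 d b a c) (Q_skew34 b c a d).
lra.
Qed.

(* R^{cf}_{ae} w_{cf}, where [Q] is the fully lowered Riemann tensor and [gi]
   the inverse metric. *)
Definition pairing a e (w : 'I_n -> 'I_n -> R) : R :=
  tr2 (fun k c => tr2 (fun l f => Q k l a e * w c f)).

(** Against a skew [w] only the part of [Q a b e l] skew in [b] and [l] counts, and by the Bianchi
    identity [Q a b e l - Q a l e b = Q b l a e]. *)
Lemma pairing_bianchi a e (w : 'I_n -> 'I_n -> R) :
  (forall c f, w c f = - w f c) ->
  2 * tr2 (fun b c => tr2 (fun l f => Q a b e l * w c f)) = pairing a e w.
Proof.
move=> sw; pose X := tr2 (fun b c => tr2 (fun l f => Q a b e l * w c f)).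
have XN : X = - tr2 (fun b c => tr2 (fun l f => Q a l e b * w c f)).
  rewrite /X exchange_tr2 -tr2N; apply: eq_tr2 => b c.
  rewrite -tr2N; apply: eq_tr2 => l f.
  by rewrite (sw f c) mulrN.
rewrite -/X mulr_natl mulr2n {1}XN /pairing -tr2N -tr2D.
apply: eq_tr2 => b c; rewrite -tr2N -tr2D; apply: eq_tr2 => l f.
rewrite -mulNr -mulrDl; congr (_ * _).
have := Q_bianchi3 a b e l.
rewrite (Q_skew34 a e l b) (Q_skew34 a l b e) (Q_pair b l a e).
lra.
Qed.

Definition ricci_lower a e : R := tr2 (fun b c => Q b a c e).

Lemma ricci_lower_sym a e : ricci_lower a e = ricci_lower e a.
Proof. by rewrite /ricci_lower tr2C; apply: eq_tr2 => b c; exact: Q_pair. Qed.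

Lemma pairing_skew a e w : pairing a e w = - pairing e a w.
Proof.
rewrite /pairing -tr2N; apply: eq_tr2 => k c; rewrite -tr2N.
by apply: eq_tr2 => l f; rewrite Q_skew34 mulNr.
Qed.

(** Cyclic relabelling of the three contracted pairs leaves the contraction unchanged, so three
    times it is the contraction with a cyclic sum of [Q], which is zero. *)
Lemma tr2_bianchi e (z : 'I_n -> 'I_n -> 'I_n -> R) :
  (forall c d f, z c d f = z d f c) ->
  tr2 (fun a d => tr2 (fun b c => tr2 (fun l f => Q a b e l * z d c f))) = 0.
Proof.
move=> cyc; pose X (q : 'I_n -> 'I_n -> 'I_n -> R) :=
  tr2 (fun a d => tr2 (fun b c => tr2 (fun l f => q a b l * z d c f))).
have XC q : X q = X (fun a b l => q l a b).
  rewrite /X exchange_tr2; apply: eq_tr2 => b c; rewrite exchange_tr2.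
  by do 2!(apply: eq_tr2 => ? ?); rewrite cyc.
have XD q q' : X (fun a b l => q a b l + q' a b l) = X q + X q'.
  rewrite -tr2D; apply: eq_tr2 => a d; rewrite -tr2D; apply: eq_tr2 => b c.
  by rewrite -tr2D; apply: eq_tr2 => l f; rewrite mulrDl.
have X0 : X (fun a b l => Q a b e l + Q l a e b + Q b l e a) = 0.
  rewrite /X -[RHS](mul0r (tr2 g)) -tr2Z; apply: eq_tr2 => a d.
  rewrite mul0r -[RHS](mul0r (tr2 g)) -tr2Z; apply: eq_tr2 => b c.
  rewrite mul0r -[RHS](mul0r (tr2 g)) -tr2Z; apply: eq_tr2 => l f.
  have := Q_bianchi3 e a b l; rewrite (Q_pair e a) (Q_pair e b) (Q_pair e l).
  by move=> B; rewrite mul0r [X in X * _](_ : _ = 0) ?mul0r//; lra.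
have := X0; rewrite !XD -(XC (fun a b l => Q a b e l)).
rewrite -(XC (fun a b l => Q l a e b)) -(XC (fun a b l => Q a b e l)) /X.
by move=> ?; lra.
Qed.

(** * Successive traces of the integrability condition *)

Section ConformalKillingYano.
Variables (m : nat) (H : m.+2.-tuple 'I_n -> R).
Variables (h' : 'I_n -> m.+1.-tuple 'I_n -> R) (kappa : R).
Hypothesis H_alt : alternating H.
Hypothesis h'_alt : forall a, alternating (h' a).
Hypothesis mn : (m.+2 < n)%N.
Hypothesis kappa0 : kappa != 0.
Hypothesis integrability : forall a b c J,
  tr2 (fun l f => Q a b c l * H (f ::: J))
  + \sum_(i < m.+1) tr2 (fun l f => Q a b (tnth J i) l * H (c ::: replace J i f))
  = kappa * ((g b c * h' a J - \sum_i g b (tnth J i) * h' a (replace J i c))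
             - (g a c * h' b J - \sum_i g a (tnth J i) * h' b (replace J i c))).

Let w J i c f := H (c ::: replace J i f).

Let w_skew J i c f : w J i c f = - w J i f c.
Proof. exact: alternating_swap. Qed.

(** The curvature side of [integrability] contracted over [b] and [c]. The minus sign appears
    because these are slots 2 and 3 of [Q], while the Ricci tensor contracts slots 1 and 3. *)
Let trace a J := - tr2 (fun l f => ricci_lower a l * H (f ::: J))
  + \sum_(i < m.+1) 2^-1 * pairing a (tnth J i) (w J i).

Let tau J i := tr2 (fun b c => h' b (replace J i c)).

(** The trace of [g] gives [n], each of the [m.+1] replacements restores [J] and gives [-1], and
    [g a c] gives one more [-1]. *)
Let traceE a J : trace a J = kappa * ((n%:R - m.+2%:R) * h' a J
  + \sum_(i < m.+1) g a (tnth J i) * tau J i).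
Proof.
have := eq_tr2 (fun b c => integrability a b c J).
rewrite tr2D [X in _ + X]tr2_sum tr2Z => E.
transitivity (kappa * (n%:R * h' a J - \sum_(i < m.+1) h' a J
   - (h' a J - \sum_i g a (tnth J i) * tau J i))); last first.
  by rewrite sumr_const card_ord -[X in _ - X - _]mulr_natl -(natr1 m.+1);
    congr (_ * _); ring.
transitivity (kappa * tr2 (fun b c =>
    (g b c * h' a J - \sum_i g b (tnth J i) * h' a (replace J i c))
    - (g a c * h' b J - \sum_i g a (tnth J i) * h' b (replace J i c)))).
  rewrite -E; congr (_ + _).
    rewrite exchange_tr2 -tr2N; apply: eq_tr2 => l f.
    rewrite /ricci_lower mulrC -tr2Z -tr2N; apply: eq_tr2 => b c.
    by rewrite [Q b a _ _]Q_skew12 mulrN opprK mulrC.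
  apply: eq_bigr => i _; rewrite -(pairing_bianchi _ _ (w_skew J i)).
  by rewrite mulrA mulVf ?mul1r ?pnatr_eq0.
congr (_ * _); rewrite tr2D tr2N !tr2D !tr2N !tr2_sum; congr (_ - _ - (_ - _)).
- under eq_tr2 do rewrite mulrC.
  by rewrite tr2Z tr2_metric mulrC.
- by apply: eq_bigr => i _; rewrite tr2_metricl replace_id.
- by rewrite tr2C; under eq_tr2 do rewrite g_sym; rewrite tr2_metricl.
- by apply: eq_bigr => i _; rewrite tr2Z.
Qed.

Let trh E := tr2 (fun b c => h' b (c ::: E)).

Let tau0 d E : tau (d ::: E) ord0 = trh E.
Proof. by apply: eq_tr2 => b c; rewrite replace_cons0. Qed.

Let tauS d E i : tau (d ::: E) (lift ord0 i) = - trh (replace E i d).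
Proof.
rewrite -tr2N; apply: eq_tr2 => b c; rewrite replace_consS.
exact: alternating_swap.
Qed.

Let trace_trace E : tr2 (fun a d => trace a (d ::: E)) = 0.
Proof.
rewrite tr2D tr2N [X in _ + X]tr2_sum big_ord_recl.
rewrite [X in _ + (X + _)]tr2_skew ?add0r; last first.
  move=> a d; rewrite -mulrN -pairing_skew !tnth_cons0.
  congr (_ * pairing _ _ _).
  by apply/funext => c; apply/funext => f; rewrite /w !replace_cons0.
rewrite big1 ?addr0; last first.
  move=> i _; rewrite -[RHS](tr2_bianchi (tnth E i)
    (z := fun d c f => H (c ::: d ::: replace E i f))).
    apply: eq_tr2 => a d; rewrite -(pairing_bianchi _ _ (w_skew _ _)).
    rewrite mulrA mulVf ?mul1r ?pnatr_eq0// tnth_consS.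
    by do 2!(apply: eq_tr2 => ? ?); rewrite /w replace_consS.
  (* A cyclic shift of three slots is a product of two transpositions, so it preserves [H]. *)
  move=> c d f.
  rewrite (alternating_swap2 _ _ _ H_alt).
  have := alternating_swap c (d ::: E) (lift ord0 i) f H_alt.
  by rewrite !replace_consS => ->; rewrite opprK.
pose X := tr2 (fun a d => tr2 (fun l f => ricci_lower a l * H (f ::: d ::: E))).
suff : X = - X by rewrite -/X => ?; lra.
rewrite {1}/X exchange_tr2 -tr2N; apply: eq_tr2 => l f.
rewrite -tr2N; apply: eq_tr2 => a d.
by rewrite ricci_lower_sym (alternating_swap2 _ _ _ H_alt) mulrN.
Qed.

Let trh0 E : trh E = 0.
Proof.
have := trace_trace E; under eq_tr2 do rewrite traceE.
rewrite tr2Z => /eqP; rewrite mulf_eq0 (negbTE kappa0) /= => /eqP.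
rewrite tr2D tr2Z tr2_sum big_ord_recl -/(trh E).
have -> : tr2 (fun a d => g a (tnth (d ::: E) ord0) * tau (d ::: E) ord0)
    = n%:R * trh E.
  rewrite -tr2_metric mulrC -tr2Z; apply: eq_tr2 => a d.
  by rewrite tau0 mulrC.
(* Contraction with [g] puts the [i]-th index of [E] back in its place, so each of the [m] positions
   gives [- trh E]. *)
rewrite (eq_bigr (fun=> - trh E)); last first.
  move=> i _; rewrite -[in RHS](replace_id E i).
  rewrite -[RHS](tr2_metricl _ (fun d => - trh (replace E i d))).
  by apply: eq_tr2 => a d; rewrite tnth_consS tauS.
rewrite sumr_const card_ord => E0.
have : (n%:R - m.+2%:R + n%:R - m%:R) * trh E = 0.
  by rewrite -[RHS]E0 -mulr_natl; ring.
move=> /eqP; rewrite mulf_eq0 => /orP[|/eqP//].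
have : m.+2%:R < n%:R :> R by rewrite ltr_nat.
have : m%:R < n%:R :> R by rewrite ltr_nat (ltn_trans _ mn)// ltnS leqnSn.
by move=> ? ? /eqP ?; exfalso; lra.
Qed.

(** Without its trace terms [traceE] is solved for [h']. Moving [f] behind [d] in [H] absorbs the
    minus sign of the Ricci term. *)
Lemma cky_derivative a d E : h' a (d ::: E) =
  (kappa * (n - m.+2)%:R)^-1 *
  (tr2 (fun l f => ricci_lower a l * H (d ::: f ::: E))
   + 2^-1 * pairing a d (fun c f => H (c ::: f ::: E))
   + \sum_(i < m) 2^-1 *
      pairing a (tnth E i) (fun c f => H (c ::: d ::: replace E i f))).
Proof.
have nm0 : (n - m.+2)%:R != 0 :> R by rewrite pnatr_eq0 subn_eq0 -ltnNge.
have := traceE a (d ::: E); rewrite [X in _ + X]big1; last first.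
  move=> i _; case: (unliftP ord0 i) => [j|] ->.
    by rewrite tauS trh0 oppr0 mulr0.
  by rewrite tau0 trh0 mulr0.
rewrite addr0 -natrB 1?ltnW// mulrA => /esym E0.
apply: (canRL (mulKf _)); first by rewrite mulf_neq0.
rewrite {}E0 /trace big_ord_recl tnth_cons0 addrA; congr (_ + _ + _).
- rewrite -tr2N; apply: eq_tr2 => l f.
  by rewrite (alternating_swap2 _ _ _ H_alt) mulrN opprK.
- congr (_ * pairing _ _ _); apply/funext => c; apply/funext => f.
  by rewrite /w replace_cons0.
- apply: eq_bigr => i _; rewrite tnth_consS; congr (_ * pairing _ _ _).
  by apply/funext => c; apply/funext => f; rewrite /w replace_consS.
Qed.

End ConformalKillingYano.

End Contraction.

(** * The closed conformal Killing-Yano equation *)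

Section SecondDerivative.
Variables (R : realType) (n : nat) (G : components R n 2) (U : set 'rV[R]_n).
Hypothesis U_open : open U.
Hypothesis G_smooth : forall I, smooth_on U (fun y => G y I).
Hypothesis G_sym :
  forall y, U y -> forall a b, G y [tuple a; b] = G y [tuple b; a].
Hypothesis G_unit :
  forall y, U y -> \matrix_(a, b) G y [tuple a; b] \in unitmx.
Variables (k : nat) (H : components R n k.+1) (h : components R n k).
Hypothesis h_smooth : forall I, smooth_on U (fun y => h y I).
Hypothesis H_cky : forall y, U y -> forall a (B : k.+1.-tuple 'I_n),
  covd G H y (a ::: B) = 2 * antisym (fun I =>
    G y [tuple a; thead I] * h y (behead_tuple I)) B.

(** Near [x] the right-hand side of the equation is a linear combination of tensor products, one for
    each permutation, so the Leibniz rule applies termwise. *)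
Lemma covd_covd_cky x a b (B : k.+1.-tuple 'I_n) : U x ->
  covd G (covd G H) x (a ::: b ::: B) = 2 * antisym (fun I =>
    G x [tuple b; thead I] * covd G h x (a ::: behead_tuple I)) B.
Proof.
move=> Ux.
(* In the summand of [s] the metric takes the first index and the one that [s] brings to the front
   of the others; [h] takes the rest. *)
pose sg (s : 'S_k.+1) (z : 'I_2 + 'I_k) : 'I_k.+2 := match z with
  | inl i => if i == ord0 then ord0 else lift ord0 (s ord0)
  | inr j => lift ord0 (s (lift ord0 j)) end.
have sg_bij s : bijective (sg s).
  apply: inj_card_bij; last by rewrite card_sum !card_ord.
  have I2 (i : 'I_2) : i != ord0 -> i = lift ord0 ord0.
    by case: (unliftP ord0 i) => [j|] ->//; rewrite (ord1 j).
  move=> [i|i] [j|j] /=.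
  - case: eqP => [->|/eqP/I2 ->]; case: eqP => [->|/eqP/I2 ->]//.
  - by case: ifP => // _ /lift_inj/perm_inj.
  - by case: ifP => // _ /lift_inj/perm_inj.
  - by move=> /lift_inj/perm_inj/lift_inj ->.
pose wt (s : 'S_k.+1) : R := 2 * (k.+1`!%:R^-1 * (-1) ^+ s).
pose F (s : 'S_k.+1) : components R n k.+2 := fun y J =>
  G y (select J (sg s \o inl)) * h y (select J (sg s \o inr)).
have selL c s : select (c ::: B) (sg s \o inl)
    = [tuple c; thead (permute B s)].
  by rewrite [LHS]pair_tuple !tnth_select /= tnth_consS /thead tnth_permute.
have selR c (C : k.+1.-tuple 'I_n) s :
    select (c ::: C) (sg s \o inr) = behead_tuple (permute C s).
  apply: eq_from_tnth => j; rewrite tnth_select /= tnth_consS -tnth_permute.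
  by case/tupleP: (permute C s) => e I; rewrite -[[tuple of _]]/(e ::: I)
    behead_cons tnth_consS.
rewrite (@covd_near _ _ _ _ _ (fun y J => \sum_s wt s * F s y J)); last first.
  apply: (near_chart U_open) => // y Uy; apply/funext => J.
  case/tupleP: J => c C; rewrite -[[tuple of _]]/(c ::: C) H_cky//.
  rewrite /antisym mulrA mulr_sumr; apply: eq_bigr => s _.
  rewrite /wt /F !mulrA selR; congr (_ * G y _ * _).
  by rewrite [RHS]pair_tuple !tnth_select /= tnth_consS /thead tnth_permute.
have dG J : pderivable (fun y => G y J) x.
  exact: smooth_pderivable (G_smooth J) Ux.
have dh J : pderivable (fun y => h y J) x.
  exact: smooth_pderivable (h_smooth J) Ux.
rewrite covd_lincomb => [|s J]; last exact: pderivableM.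
rewrite /antisym mulrA mulr_sumr; apply: eq_bigr => s _.
rewrite covd_prod// (covd_metric U_open)// mul0r add0r.
by rewrite selL selR /wt !mulrA.
Qed.

End SecondDerivative.

(** * Curvature terms of the statement as traces of the lowered tensor *)

Section CurvatureTerms.
Variables (R : realType) (n : nat) (M : manifold R n) (g : metric M).
Variables (Rm : curvature_components M) (c : chart_index M) (x : 'rV[R]_n).
Let gx a b := g c x [tuple a; b].
Let gi := metric_inv (g c) x.
Let Q := lower (g c) (Rm c) x.
Hypothesis gi_sym : forall a b, gi a b = gi b a.
Hypothesis gK : forall a b, \sum_f gx a f * gi f b = (a == b)%:R.

Lemma riem_up12_pairing b e (w : 'I_n -> 'I_n -> R) :
  \sum_(a < n) \sum_(f < n) riem_up12 g Rm c x a f b e * w a f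
  = pairing gi Q b e w.
Proof.
rewrite /pairing /tr2 [RHS]exchange_big; apply: eq_bigr => a _ /=.
under eq_bigr do rewrite /riem_up12 mulr_suml.
rewrite exchange_big; apply: eq_bigr => i _ /=.
rewrite [in RHS]exchange_big mulr_sumr; apply: eq_bigr => f _.
rewrite mulr_suml mulr_sumr; apply: eq_bigr => j _.
by rewrite [gi i a]gi_sym [gi j f]gi_sym !mulrA.
Qed.

Lemma ricci_raise i j :
  ricci g Rm c x i j = \sum_(l < n) gi i l * ricci_lower gi Q l j.
Proof.
rewrite /ricci /riem_up12.
under eq_bigr do rewrite exchange_big /=.
rewrite exchange_big; apply: eq_bigr => l _ /=.
rewrite /ricci_lower /tr2 [in RHS]exchange_big mulr_sumr; apply: eq_bigr => e _.
rewrite mulr_sumr; apply: eq_bigr => k _.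
by rewrite [gi k e]gi_sym [in RHS]mulrCA mulrA.
Qed.

(** [ricci_down_up] lowers the index that [ricci] has raised, so one metric cancels against its
    inverse. *)
Lemma ricci_down_up_tr2 b (X : 'I_n -> R) :
  \sum_(f < n) ricci_down_up g Rm c x b f * X f
  = tr2 gi (fun l f => ricci_lower gi Q b l * X f).
Proof.
rewrite /tr2 [RHS]exchange_big; apply: eq_bigr => f _ /=.
rewrite /ricci_down_up exchange_big mulr_suml; apply: eq_bigr => j _ /=.
have -> : ricci_lower gi Q b j = \sum_i gx b i * ricci g Rm c x i j.
  under eq_bigr do rewrite ricci_raise mulr_sumr.
  rewrite exchange_big (bigD1 b)//= [X in _ + X]big1 => [|l lb].
    under eq_bigr do rewrite mulrA.
    by rewrite -mulr_suml gK eqxx mul1r addr0.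
  under eq_bigr do rewrite mulrA.
  by rewrite -mulr_suml gK eq_sym (negbTE lb) mul0r.
rewrite mulrA mulr_sumr; congr (_ * _); apply: eq_bigr => i _.
by rewrite [gi j f]gi_sym -mulrA mulrCA.
Qed.

Lemma riemann_tr2 a b d (X : 'I_n -> R) :
  \sum_(f < n) Rm c x a b d f * X f = tr2 gi (fun l f => Q a b d l * X f).
Proof.
rewrite /tr2 [RHS]exchange_big; apply: eq_bigr => f _ /=.
under eq_bigr do rewrite mulrA.
rewrite -mulr_suml; congr (_ * _).
rewrite /Q /lower; under eq_bigr do rewrite mulr_sumr.
rewrite exchange_big (bigD1 f)//= [X in _ + X]big1 => [|e ef].
  under eq_bigr do rewrite mulrC -mulrA.
  by rewrite -mulr_sumr gK eqxx mulr1 addr0.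
under eq_bigr do rewrite mulrC -mulrA.
by rewrite -mulr_sumr gK (negbTE ef) mulr0.
Qed.

End CurvatureTerms.

(* The order is p = m.+2, so that p >= 2 and the block E has m = p - 2
   indices. *)
Theorem mainTheorem3 (R : realType) (n m : nat) (hpn : (m.+2 < n)%N)
    (M : manifold R n) (g : metric M)
    (Rm : curvature_components M) (hRm : is_riemann g Rm)
    (H : tensorField M m.+2) (h : tensorField M m.+1)
    (hH : closed_CKY_with g H h)
    (c : chart_index M) (x : 'rV[R]_n) (hx : coord_dom c x) :
  let p := m.+2 in
  let h' := covd (g c) (h c) x in
  (forall (b d : 'I_n) (E : m.-tuple 'I_n),
     h' [tuple of b :: d :: E] =
     p%:R / (4 * (n - p)%:R) *
     (2 * (\sum_(f < n)
             ricci_down_up g Rm c x b f * H c x [tuple of d :: f :: E])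
      + \sum_(a < n) \sum_(f < n)
          riem_up12 g Rm c x a f b d * H c x [tuple of a :: f :: E]
      + \sum_(i < m) \sum_(a < n) \sum_(f < n)
          riem_up12 g Rm c x a f b (tnth E i) *
          H c x [tuple of a :: d :: replace E i f]))
  /\
  (forall (a b e d : 'I_n) (E : m.-tuple 'I_n),
     \sum_(f < n) Rm c x a b e f * H c x [tuple of f :: d :: E]
     + \sum_(f < n) Rm c x a b d f * H c x [tuple of e :: f :: E]
     + \sum_(i < m) \sum_(f < n)
         Rm c x a b (tnth E i) f * H c x [tuple of e :: d :: replace E i f]
     - 2 * hp_g_antisym h' (g c x) a b d E e
     + 2 * hp_g_antisym h' (g c x) b a d E e = 0).
Proof.
case: hH => skH skh cky p h'.
have U_open : open (coord_dom c) by exact: chart_img_open.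
have G_smooth I : smooth_on (coord_dom c) (fun y => g c y I).
  exact: tcomp_smooth.
have G_sym := @Defs.metric_sym _ _ _ g c.
have G_unit := @Defs.metric_nondeg _ _ _ g c.
have h_smooth I : smooth_on (coord_dom c) (fun y => h c y I).
  exact: tcomp_smooth.
have H_smooth I : smooth_on (coord_dom c) (fun y => H c y I).
  exact: tcomp_smooth.
pose gx a b := g c x [tuple a; b].
pose hp a J := covd (g c) (h c) x (a ::: J).
have hp_alt a : alternating (hp a).
  move=> J s; apply: covd_permute.
    by move=> I; exact: smooth_pderivable (h_smooth I) hx.
  by apply: (near_chart U_open) => // y Uy I; exact: skh.
have H_alt : alternating (H c x) by move=> J s; exact: skH.
have id2 a b B : \sum_(i < m.+2) \sum_(f < n)
    Rm c x a b (tnth B i) f * H c x (replace B i f)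
  = 2 * antisym (fun I => gx b (thead I) * hp a (behead_tuple I)) B
    - 2 * antisym (fun I => gx a (thead I) * hp b (behead_tuple I)) B.
  rewrite -(ricci_identity U_open G_smooth G_sym G_unit (hRm c) hx _ _ _ H_smooth).
  by rewrite !(covd_covd_cky U_open G_smooth G_sym G_unit h_smooth (cky c))//.
have gx_sym a b : gx a b = gx b a by exact: G_sym.
have gi_sym a b := metric_inv_sym G_sym a b hx.
have gK a b := metric_invK G_unit a b hx.
split; last first.
  move=> a b e d E.
  have := id2 a b (e ::: d ::: E).
  rewrite !big_ord_recl addrA => id2E.
  rewrite !hp_g_antisymE.
  have -> : antisym (fun I : m.+2.-tuple 'I_n => g c x [tuple thead I; b]
      * h' (a ::: behead_tuple I)) (e ::: d ::: E)
    = antisym (fun I => gx b (thead I) * hp a (behead_tuple I)) (e ::: d ::: E).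
    by apply: antisym_ext => I; rewrite (G_sym x hx).
  have -> : antisym (fun I : m.+2.-tuple 'I_n => g c x [tuple thead I; a]
      * h' (b ::: behead_tuple I)) (e ::: d ::: E)
    = antisym (fun I => gx a (thead I) * hp b (behead_tuple I)) (e ::: d ::: E).
    by apply: antisym_ext => I; rewrite (G_sym x hx).
  apply/eqP; rewrite addrAC subr_eq0 eq_sym -subr_eq -id2E; apply/eqP.
  congr (_ + _ + _).
  - by apply: eq_bigr => f _; rewrite replace_cons0.
  - by apply: eq_bigr => f _; rewrite replace_consS replace_cons0.
  - apply: eq_bigr => i _; apply: eq_bigr => f _.
    by rewrite !replace_consS !tnth_consS.
move=> b d E.
pose gi := metric_inv (g c) x.
pose Q := lower (g c) (Rm c) x.
have integ a b' e J :
    tr2 gi (fun l f => Q a b' e l * H c x (f ::: J))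
    + \sum_(i < m.+1) tr2 gi (fun l f => Q a b' (tnth J i) l
        * H c x (e ::: replace J i f))
    = 2 / m.+2%:R
      * ((gx b' e * hp a J - \sum_i gx b' (tnth J i) * hp a (replace J i e))
         - (gx a e * hp b' J - \sum_i gx a (tnth J i) * hp b' (replace J i e))).
  (* The denominator [m.+2] is the weight from [antisym_cons], the numerator the 2 of the defining
     equation. *)
  rewrite mulrBr -![2 / _ * _]mulrA -!antisym_cons//.
  rewrite -id2 [in RHS]big_ord_recl; congr (_ + _).
    rewrite -(riemann_tr2 Rm gK); apply: eq_bigr => f _.
    by rewrite replace_cons0.
  apply: eq_bigr => i _; rewrite -(riemann_tr2 Rm gK).
  by apply: eq_bigr => f _; rewrite replace_consS tnth_consS.
have kappa0 : 2 / m.+2%:R != 0 :> R by rewrite mulf_neq0 ?invr_eq0 ?pnatr_eq0.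
have giK a e : \sum_f gi a f * gx f e = (a == e)%:R.
  rewrite eq_sym -gK; apply: eq_bigr => f _.
  by rewrite mulrC gx_sym /gi gi_sym.
have := cky_derivative gx_sym gi_sym giK
  (lower_skew34 U_open G_smooth G_sym G_unit (hRm c) hx)
  (lower_skew12 U_open G_smooth G_sym G_unit (hRm c) hx)
  (lower_pair U_open G_smooth G_sym G_unit (hRm c) hx)
  (lower_bianchi U_open G_smooth G_sym G_unit (hRm c) hx)
  H_alt hp_alt hpn kappa0 integ b d E.
rewrite -[hp b _]/(h' [tuple of b :: d :: E]) => ->.
rewrite -(ricci_down_up_tr2 Rm gi_sym gK) -(riem_up12_pairing Rm gi_sym).
under [X in _ * (_ + X)]eq_bigr do rewrite -(riem_up12_pairing Rm gi_sym).
rewrite -mulr_sumr.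
have p0 : p%:R != 0 :> R by rewrite pnatr_eq0.
have nm0 : (n - p)%:R != 0 :> R by rewrite pnatr_eq0 subn_eq0 -ltnNge.
rewrite -/p; move: p0 nm0.
set S1 := \sum_(f < n) _; set S2 := \sum_(a < n) _; set S3 := \sum_(i < m) _.
move: S1 S2 S3 (p%:R) ((n - p)%:R) => S1 S2 S3 P N p0 nm0.
(* The inverse of [2 / P * N] is [P / (2 * N)]; extracting a further one half gives [P / (4 * N)]
   and doubles the Ricci term. *)
by field; apply/andP.
Qed.
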